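(* Let $n\in\mathbb{N}$, $n\ge 1$, let $\boldsymbol\gamma^1,\ldots,\boldsymbol\gamma^n\in\mathbb{D}^2$ be pairwise distinct, and let $F:\mathbb{R}^2\to\mathbb{C}$ be $n$ times differentiable. Then the following are equivalent: (i) for all $\mathbf{v}^1,\mathbf{v}^2,\ldots,\mathbf{v}^n\in\mathbb{U}$, $$\mathcal{D}_{\mathbf{v}^1}^{\boldsymbol\gamma^1}\,\mathcal{D}_{\mathbf{v}^2}^{\boldsymbol\gamma^2}\cdots\mathcal{D}_{\mathbf{v}^n}^{\boldsymbol\gamma^n}F(\mathbf{z})=0\quad\text{for all }\mathbf{z}\in\mathbb{R}^2;$$ (ii) there exist $c_1,\ldots,c_n\in\mathbb{C}$ such that $$F(\mathbf{z})=\sum_{\ell=1}^n c_\ell\exp\big((\boldsymbol\gamma^\ell)^T\mathbf{z}\big)\quad\text{for all }\mathbf{z}\in\mathbb{R}^2.$$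
   Context: Vectors are column vectors and $^T$ denotes the transpose (no complex conjugation). $\imath$ is the imaginary unit, $\mathbb{D}:=\mathbb{R}\cup\imath(-\pi,\pi)\subset\mathbb{C}$ (each component of a vector in $\mathbb{D}^2$ is either real or purely imaginary with modulus less than $\pi$). $\mathbb{U}:=\{\mathbf{u}\in\mathbb{R}^2: |\mathbf{u}|=1\}$, where $|\cdot|$ is the Euclidean norm. For a differentiable function $F:\mathbb{R}^2\to\mathbb{C}$ with $\nabla F=\left(\frac{\partial F}{\partial z_1},\frac{\partial F}{\partial z_2}\right)^T$, a vector $\mathbf{v}\in\mathbb{R}^2\setminus\{\mathbf{0}\}$ and $\boldsymbol\gamma\in\mathbb{D}^2$, the differential operator is $$\mathcal{D}_{\mathbf{v}}^{\boldsymbol\gamma}F(\mathbf{z}):=\big(\nabla F(\mathbf{z})-\boldsymbol\gamma F(\mathbf{z})\big)^T\mathbf{v},\qquad \mathbf{z}\in\mathbb{R}^2.$$ A product of such operators denotes their composition. *)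

(* Defs.v *)
From Stdlib Require Export Reals.
From Coquelicot Require Export Coquelicot.

Open Scope R_scope.

(* Coquelicot's C is by definition R * R.  Throughout, R * R stands for the
   plane (real vectors), C for scalars, and C * C for complex vectors. *)
Definition R2 : NormedModule R_AbsRing :=
  prod_NormedModule R_AbsRing R_NormedModule R_NormedModule.

Definition Cexp (w : C) : C :=
  (exp (Re w) * cos (Im w), exp (Re w) * sin (Im w)).

(* Bilinear: no complex conjugation. *)
Definition dotC (a : C * C) (z : R * R) : C :=
  (fst a * RtoC (fst z) + snd a * RtoC (snd z))%C.

Definition in_D (g : C) : Prop :=
  Im g = 0 \/ (Re g = 0 /\ - PI < Im g < PI).

Definition in_D2 (g : C * C) : Prop := in_D (fst g) /\ in_D (snd g).

Definition in_U (u : R * R) : Prop := sqrt (fst u ^ 2 + snd u ^ 2) = 1.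

(* Derivative of a complex-valued function of a real variable. *)
Definition CDerive (f : R -> C) (t : R) : C :=
  (Derive (fun s => Re (f s)) t, Derive (fun s => Im (f s)) t).

(* Like Derive, the gradient is total; it is only meaningful at points where
   the partial derivatives exist. *)
Definition grad (F : R * R -> C) (z : R * R) : C * C :=
  (CDerive (fun t => F (t, snd z)) (fst z),
   CDerive (fun t => F (fst z, t)) (snd z)).

(* Real Frechet differentiability everywhere. *)
Definition differentiable (F : R * R -> C) : Prop :=
  forall z : R * R,
    @ex_filterdiff R_AbsRing R2 C_R_NormedModule F (@locally R2 z).

(* F is differentiable and its derivative, represented by the two components
   of the gradient, is n-1 times differentiable.  No continuity of the
   derivatives of order n is required. *)
Fixpoint n_differentiable (n : nat) (F : R * R -> C) : Prop :=
  match n with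
  | O => True
  | S m => differentiable F /\
           n_differentiable m (fun z => fst (grad F z)) /\
           n_differentiable m (fun z => snd (grad F z))
  end.

Definition Dop (g : C * C) (v : R * R) (F : R * R -> C) (z : R * R) : C :=
  dotC (fst (grad F z) - fst g * F z, snd (grad F z) - snd g * F z)%C v.

(* Families are indexed by 1, ..., n; values at other indices are irrelevant.
   Dprod gam v n F is Dop_1 (Dop_2 (... (Dop_n F))), with Dop_n applied first. *)
Fixpoint Dprod (gam : nat -> C * C) (v : nat -> R * R) (n : nat)
    (F : R * R -> C) : R * R -> C :=
  match n with
  | O => F
  | S m => Dprod gam v m (Dop (gam (S m)) (v (S m)) F)
  end.

(* Main.v *)
From Stdlib Require Import FunctionalExtensionality Lra Lia.
Require Import Defs.

(** Write e_l for the exponential of frequency gam_l.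

The operator of frequency g in direction v multiplies e_l by the scalar
(gam_l - g) . v, so it kills e_l when g = gam_l.  Hence a composition of
operators running through all the frequencies kills every combination of the
e_l: the last frequency disappears at each step ([Dop_expsum_last]).

Conversely, argue by induction on n.  Fix the direction of the innermost
operator, of frequency g = gam_n, and apply the induction hypothesis to its
value on F, once for each coordinate direction: this gives
  d_1 F = g_1 F + A,    d_2 F = g_2 F + B,
where A = sum a_l e_l and B = sum b_l e_l run over l < n.  Such a system is
solvable only if the mixed derivatives of F agree.  Here the mixed derivatives
are again built from F and exponentials, so they are continuous; Schwarz's
theorem applies and reads
  sum_l (a_l (gam_l - g)_2 - b_l (gam_l - g)_1) e_l = 0.
The e_l are linearly independent ([expsum_independent], which is again the
killing argument), so every coefficient is zero.  As gam_l <> g, the vector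
(a_l, b_l) is then d_l times gam_l - g for some d_l, and sum d_l e_l is a particular
solution of the system ([exp_system_solve]).  The difference of F and this
solution satisfies grad G = g G, so it is a multiple of e_n ([eigen_exp]). *)

(** * Derivatives of complex functions and gradients *)

(** Relational counterpart of [CDerive]: the total operator cannot record that
the derivative exists, which the product and chain rules need. *)
Definition is_Cderive (f : R -> C) (t : R) (l : C) : Prop :=
  is_derive (fun s => Re (f s)) t (Re l) /\
  is_derive (fun s => Im (f s)) t (Im l).

Lemma is_Cderive_unique f t l : is_Cderive f t l -> CDerive f t = l.
Proof.
intros [h1 h2]; apply injective_projections; now apply is_derive_unique.
Qed.

Lemma is_Cderive_eq f t l l' : is_Cderive f t l -> l = l' -> is_Cderive f t l'.
Proof. now intros h <-. Qed.

Lemma is_Cderive_const k t : is_Cderive (fun _ => k) t (RtoC 0).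
Proof. split; apply (@is_derive_const R_AbsRing R_NormedModule). Qed.

Lemma is_Cderive_RtoC t : is_Cderive RtoC t (RtoC 1).
Proof.
split; [apply (@is_derive_id R_AbsRing)|].
apply (@is_derive_const R_AbsRing R_NormedModule 0).
Qed.

Lemma is_Cderive_plus f g t l m :
  is_Cderive f t l -> is_Cderive g t m ->
  is_Cderive (fun s => f s + g s)%C t (l + m)%C.
Proof.
intros [f1 f2] [g1 g2]; split.
- apply (is_derive_plus (fun s => Re (f s)) (fun s => Re (g s)) t _ _ f1 g1).
- apply (is_derive_plus (fun s => Im (f s)) (fun s => Im (g s)) t _ _ f2 g2).
Qed.

Lemma is_derive_Rmult (a b : R -> R) (t a' b' : R) :
  is_derive a t a' -> is_derive b t b' ->
  is_derive (fun s => a s * b s) t (a' * b t + a t * b').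
Proof. intros ha hb; apply (is_derive_mult a b t a' b' ha hb Rmult_comm). Qed.

Lemma is_Cderive_mult f g t l m :
  is_Cderive f t l -> is_Cderive g t m ->
  is_Cderive (fun s => f s * g s)%C t (l * g t + f t * m)%C.
Proof.
intros [f1 f2] [g1 g2]; split.
- replace (Re _) with ((Re l * Re (g t) + Re (f t) * Re m) -
    (Im l * Im (g t) + Im (f t) * Im m))
    by (unfold Cplus, Cmult, Re, Im; simpl; ring).
  apply (is_derive_minus _ _ t _ _ (is_derive_Rmult _ _ _ _ _ f1 g1)
    (is_derive_Rmult _ _ _ _ _ f2 g2)).
- replace (Im _) with ((Re l * Im (g t) + Re (f t) * Im m) +
    (Im l * Re (g t) + Im (f t) * Re m))
    by (unfold Cplus, Cmult, Re, Im; simpl; ring).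
  apply (is_derive_plus _ _ t _ _ (is_derive_Rmult _ _ _ _ _ f1 g2)
    (is_derive_Rmult _ _ _ _ _ f2 g1)).
Qed.

Lemma is_Cderive_exp f t l :
  is_Cderive f t l ->
  is_Cderive (fun s => Cexp (f s)) t (l * Cexp (f t))%C.
Proof.
intros [f1 f2].
pose proof (is_derive_comp exp _ t _ _ (is_derive_exp _) f1) as he.
pose proof (is_derive_comp cos _ t _ _ (is_derive_cos _) f2) as hc.
pose proof (is_derive_comp sin _ t _ _ (is_derive_sin _) f2) as hs.
split.
- replace (Re _) with (Re l * exp (Re (f t)) * cos (Im (f t)) +
    exp (Re (f t)) * (Im l * - sin (Im (f t))))
    by (unfold Cexp, Cmult, Re, Im; simpl; ring).
  apply (is_derive_Rmult _ _ _ _ _ he hc).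
- replace (Im _) with (Re l * exp (Re (f t)) * sin (Im (f t)) +
    exp (Re (f t)) * (Im l * cos (Im (f t))))
    by (unfold Cexp, Cmult, Re, Im; simpl; ring).
  apply (is_derive_Rmult _ _ _ _ _ he hs).
Qed.

Definition is_grad (F : R * R -> C) (z : R * R) (a b : C) : Prop :=
  is_Cderive (fun t => F (t, snd z)) (fst z) a /\
  is_Cderive (fun t => F (fst z, t)) (snd z) b.

Lemma is_grad_unique F z a b : is_grad F z a b -> grad F z = (a, b).
Proof.
intros [h1 h2]; unfold grad.
now rewrite (is_Cderive_unique _ _ _ h1), (is_Cderive_unique _ _ _ h2).
Qed.

Lemma is_grad_eq F z a b a' b' :
  is_grad F z a b -> a = a' -> b = b' -> is_grad F z a' b'.
Proof. now intros h <- <-. Qed.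

Lemma is_grad_const k z : is_grad (fun _ => k) z (RtoC 0) (RtoC 0).
Proof. split; apply is_Cderive_const. Qed.

Lemma is_grad_plus F G z a b a' b' :
  is_grad F z a b -> is_grad G z a' b' ->
  is_grad (fun z => F z + G z)%C z (a + a')%C (b + b')%C.
Proof. intros [h1 h2] [h3 h4]; split; now apply is_Cderive_plus. Qed.

Lemma is_grad_mult F G z a b a' b' :
  is_grad F z a b -> is_grad G z a' b' ->
  is_grad (fun z => F z * G z)%C z
    (a * G z + F z * a')%C (b * G z + F z * b')%C.
Proof.
intros [h1 h2] [h3 h4]; destruct z as [x y]; split.
- apply (is_Cderive_mult _ _ _ _ _ h1 h3).
- apply (is_Cderive_mult _ _ _ _ _ h2 h4).
Qed.

Lemma is_grad_scal k F z a b :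
  is_grad F z a b -> is_grad (fun z => k * F z)%C z (k * a)%C (k * b)%C.
Proof.
intros h; eapply is_grad_eq;
  [apply (is_grad_mult (fun _ => k) F); [apply is_grad_const | exact h] | |];
  ring.
Qed.

Lemma is_grad_exp g z :
  is_grad (fun z => Cexp (dotC g z)) z
    (fst g * Cexp (dotC g z))%C (snd g * Cexp (dotC g z))%C.
Proof.
destruct z as [x y]; split; simpl.
- apply (is_Cderive_exp (fun t => dotC g (t, y))); unfold dotC; simpl.
  eapply is_Cderive_eq; [apply is_Cderive_plus;
    [apply is_Cderive_mult; [apply is_Cderive_const|apply is_Cderive_RtoC]
    |apply is_Cderive_const]|cbv beta; ring].
- apply (is_Cderive_exp (fun t => dotC g (x, t))); unfold dotC; simpl.
  eapply is_Cderive_eq; [apply is_Cderive_plus; [apply is_Cderive_const|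
    apply is_Cderive_mult; [apply is_Cderive_const|apply is_Cderive_RtoC]]|cbv beta; ring].
Qed.

(** * The homogeneous equation *)

Lemma Cexp_plus a b : Cexp (a + b) = (Cexp a * Cexp b)%C.
Proof.
unfold Cexp, Cmult, Cplus, Re, Im; simpl.
rewrite exp_plus, cos_plus, sin_plus.
f_equal; ring.
Qed.

Lemma Cexp_0 : Cexp (RtoC 0) = RtoC 1.
Proof.
unfold Cexp, RtoC, Re, Im; simpl.
rewrite exp_0, cos_0, sin_0; f_equal; ring.
Qed.

Lemma Cexp_opp a : (Cexp (- a) * Cexp a)%C = RtoC 1.
Proof. rewrite <- Cexp_plus, <- Cexp_0; f_equal; ring. Qed.

Lemma Cexp_neq0 a : Cexp a <> RtoC 0.
Proof.
intros h; generalize (Cexp_opp a); rewrite h, Cmult_0_r.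
intros e; injection e; lra.
Qed.

Lemma is_grad_0_const G :
  (forall z, is_grad G z (RtoC 0) (RtoC 0)) -> forall z, G z = G (0, 0).
Proof.
assert (const : forall f : R -> R,
    (forall t, is_derive f t 0) -> forall x y, f x = f y).
{ intros f hf x y.
  destruct (Rtotal_order x y) as [h | [-> | h]]; [|reflexivity|];
    [|symmetry]; apply (@eq_is_derive R_NormedModule); auto. }
intros hG [x y].
transitivity (G (0, y)); apply injective_projections.
- apply (const (fun t => Re (G (t, y)))); intros t; apply (hG (t, y)).
- apply (const (fun t => Im (G (t, y)))); intros t; apply (hG (t, y)).
- apply (const (fun t => Re (G (0, t)))); intros t; apply (hG (0, t)).
- apply (const (fun t => Im (G (0, t)))); intros t; apply (hG (0, t)).
Qed.

(** The product of G by the exponential of frequency -g has zero gradient. *)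
Lemma eigen_exp g G :
  (forall z, is_grad G z (fst g * G z)%C (snd g * G z)%C) ->
  exists k, forall z, G z = (k * Cexp (dotC g z))%C.
Proof.
intros hG.
set (g' := (- fst g, - snd g)%C).
assert (opp : forall z, dotC g' z = (- dotC g z)%C).
{ intros z; unfold dotC, g'; simpl; ring. }
exists (G (0, 0) * Cexp (dotC g' (0, 0)))%C; intros z.
rewrite <- (is_grad_0_const (fun z => G z * Cexp (dotC g' z))%C) with (z := z).
- rewrite opp, <- Cmult_assoc, Cexp_opp; ring.
- intros w; eapply is_grad_eq;
    [apply is_grad_mult; [apply hG|apply is_grad_exp]| |]; simpl; ring.
Qed.

(** * Differentiable functions *)

Lemma ex_filterdiff_is_Cderive (f : R -> C) t :
  @ex_filterdiff R_AbsRing R_NormedModule C_R_NormedModule f (locally t) ->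
  is_Cderive f t (CDerive f t).
Proof.
intros hf; split; apply Derive_correct, ex_derive_filterdiff.
- apply (@ex_filterdiff_comp' R_AbsRing R_NormedModule C_R_NormedModule
    R_NormedModule f (fun w => Re w) t hf).
  apply ex_filterdiff_linear.
  apply (@is_linear_fst R_AbsRing R_NormedModule R_NormedModule).
- apply (@ex_filterdiff_comp' R_AbsRing R_NormedModule C_R_NormedModule
    R_NormedModule f (fun w => Im w) t hf).
  apply ex_filterdiff_linear.
  apply (@is_linear_snd R_AbsRing R_NormedModule R_NormedModule).
Qed.

(** Restrict F to the horizontal and vertical lines through z, which are affine
maps R -> R^2, and apply the chain rule. *)
Lemma differentiable_is_grad F z :
  differentiable F -> is_grad F z (fst (grad F z)) (snd (grad F z)).
Proof.
intros hF; destruct z as [x y].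
assert (coord : forall l : R -> R * R, forall w : R * R,
    @is_linear R_AbsRing R_NormedModule R2 l -> forall t,
    @ex_filterdiff R_AbsRing R_NormedModule C_R_NormedModule
      (fun s => F (plus (l s : R2) (w : R2))) (locally t)).
{ intros l w hl t.
  apply (@ex_filterdiff_comp' R_AbsRing R_NormedModule R2 C_R_NormedModule
    (fun s => plus (l s : R2) (w : R2)) F t); [|apply hF].
  apply (@ex_filterdiff_plus_fct R_AbsRing R_NormedModule R2 (locally t) _).
  - now apply ex_filterdiff_linear.
  - apply ex_filterdiff_const. }
split; simpl.
- apply ex_filterdiff_is_Cderive.
  apply ex_filterdiff_ext with
    (fun s : R => F (plus ((s, 0) : R2) ((0, y) : R2))).
  + intros t; apply (f_equal F), injective_projections;
      [apply Rplus_0_r | apply Rplus_0_l].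
  + apply (coord (fun s => (s, 0))).
    apply (@is_linear_prod R_AbsRing R_NormedModule R_NormedModule R_NormedModule
      (fun s => s) (fun _ => zero)); [apply is_linear_id|apply is_linear_zero].
- apply ex_filterdiff_is_Cderive.
  apply ex_filterdiff_ext with
    (fun s : R => F (plus ((0, s) : R2) ((x, 0) : R2))).
  + intros t; apply (f_equal F), injective_projections;
      [apply Rplus_0_l | apply Rplus_0_r].
  + apply (coord (fun s => (0, s))).
    apply (@is_linear_prod R_AbsRing R_NormedModule R_NormedModule R_NormedModule
      (fun _ => zero) (fun s => s)); [apply is_linear_zero|apply is_linear_id].
Qed.

Lemma is_linear_Cmult (k : C) :
  @is_linear R_AbsRing C_R_NormedModule C_R_NormedModule (Cmult k).
Proof.
assert (lin : forall a b : R, @is_linear R_AbsRing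
    (prod_NormedModule R_AbsRing R_NormedModule R_NormedModule) R_NormedModule
    (fun w => a * fst w + b * snd w)).
{ intros a b.
  apply (is_linear_comp (fun w => (a * fst w, b * snd w))
    (fun w => plus (fst w) (snd w))); [|apply is_linear_plus].
  apply is_linear_prod.
  - apply (is_linear_comp (fun w => fst w) (fun s : R => a * s));
      [apply is_linear_fst | apply (@is_linear_scal_r R_AbsRing R_NormedModule a Rmult_comm)].
  - apply (is_linear_comp (fun w => snd w) (fun s : R => b * s));
      [apply is_linear_snd | apply (@is_linear_scal_r R_AbsRing R_NormedModule b Rmult_comm)]. }
refine (is_linear_ext (fun w : C_R_NormedModule =>
  (fst k * fst w + - snd k * snd w, snd k * fst w + fst k * snd w)) _ _ _).
- intros w; unfold Cmult; f_equal; ring.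
- apply (is_linear_prod _ _ (lin (fst k) (- snd k)) (lin (snd k) (fst k))).
Qed.

Lemma differentiable_lin a b F G :
  differentiable F -> differentiable G ->
  differentiable (fun z => a * F z + b * G z)%C.
Proof.
assert (scal : forall k H, differentiable H ->
    differentiable (fun z => k * H z)%C).
{ intros k H hH z.
  apply (@ex_filterdiff_comp' R_AbsRing R2 C_R_NormedModule C_R_NormedModule
    H (Cmult k) z (hH z)).
  apply ex_filterdiff_linear, is_linear_Cmult. }
intros hF hG z.
apply (@ex_filterdiff_plus_fct R_AbsRing R2 C_R_NormedModule (locally z) _
  (fun z => a * F z)%C (fun z => b * G z)%C); now apply scal.
Qed.

Lemma n_differentiable_lin m a b F G :
  n_differentiable m F -> n_differentiable m G ->
  n_differentiable m (fun z => a * F z + b * G z)%C.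
Proof.
revert F G; induction m as [|m IH]; intros F G; [easy|].
intros [hF [F1 F2]] [hG [G1 G2]]; split; [now apply differentiable_lin|].
assert (e : forall z, grad (fun z => a * F z + b * G z)%C z =
  (a * fst (grad F z) + b * fst (grad G z),
   a * snd (grad F z) + b * snd (grad G z))%C).
{ intros z; apply is_grad_unique, is_grad_plus; apply is_grad_scal;
    now apply differentiable_is_grad. }
split.
- rewrite (functional_extensionality _
    (fun z => a * fst (grad F z) + b * fst (grad G z))%C);
    [now apply IH | now intros z; rewrite e].
- rewrite (functional_extensionality _
    (fun z => a * snd (grad F z) + b * snd (grad G z))%C);
    [now apply IH | now intros z; rewrite e].
Qed.

Lemma n_differentiable_pred m F :
  n_differentiable (S m) F -> n_differentiable m F.
Proof.
revert F; induction m as [|m IH]; intros F; [easy|].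
intros [hF [F1 F2]]; split; [exact hF|]; split; now apply IH.
Qed.

(** The operator is a combination of the two partial derivatives and F itself,
which is what lets the induction on the number of frequencies proceed. *)
Lemma n_differentiable_Dop m g v F :
  n_differentiable (S m) F -> n_differentiable m (Dop g v F).
Proof.
intros hF; pose proof (n_differentiable_pred _ _ hF) as F0.
destruct hF as [_ [F1 F2]].
rewrite (functional_extensionality (Dop g v F) (fun z =>
  RtoC (fst v) * fst (grad F z) + RtoC 1 *
  (RtoC (snd v) * snd (grad F z) + - dotC g v * F z))%C).
- apply n_differentiable_lin; [exact F1|]; now apply n_differentiable_lin.
- intros z; unfold Dop, dotC; simpl; ring.
Qed.

(** * Continuity and equality of mixed derivatives *)

Definition Ccontinuous (P : R * R -> C) : Prop :=
  forall z : R * R,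
    continuous (fun w : R * R => Re (P w)) z /\
    continuous (fun w : R * R => Im (P w)) z.

Lemma Ccontinuous_const k : Ccontinuous (fun _ => k).
Proof. intros z; split; apply continuous_const. Qed.

Lemma Ccontinuous_plus F G :
  Ccontinuous F -> Ccontinuous G -> Ccontinuous (fun z => F z + G z)%C.
Proof.
intros hF hG z; destruct (hF z) as [f1 f2], (hG z) as [g1 g2]; split.
- exact (@continuous_plus _ R_AbsRing R_NormedModule _ _ _ f1 g1).
- exact (@continuous_plus _ R_AbsRing R_NormedModule _ _ _ f2 g2).
Qed.

Lemma Ccontinuous_mult F G :
  Ccontinuous F -> Ccontinuous G -> Ccontinuous (fun z => F z * G z)%C.
Proof.
intros hF hG z; destruct (hF z) as [f1 f2], (hG z) as [g1 g2]; split.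
- exact (@continuous_minus _ R_AbsRing R_NormedModule _ _ _
    (@continuous_mult _ R_AbsRing _ _ _ f1 g1)
    (@continuous_mult _ R_AbsRing _ _ _ f2 g2)).
- exact (@continuous_plus _ R_AbsRing R_NormedModule _ _ _
    (@continuous_mult _ R_AbsRing _ _ _ f1 g2)
    (@continuous_mult _ R_AbsRing _ _ _ f2 g1)).
Qed.

Lemma Ccontinuous_exp F : Ccontinuous F -> Ccontinuous (fun z => Cexp (F z)).
Proof.
intros hF z; destruct (hF z) as [f1 f2].
pose proof (continuous_comp _ exp z f1 (continuous_exp _)) as he.
split; apply (@continuous_mult _ R_AbsRing _ _ _ he).
- exact (continuous_comp _ cos z f2 (continuous_cos _)).
- exact (continuous_comp _ sin z f2 (continuous_sin _)).
Qed.

Lemma Ccontinuous_dotC g : Ccontinuous (dotC g).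
Proof.
assert (real : forall p : R * R -> R, (forall z : R * R, continuous p z) ->
    Ccontinuous (fun z => RtoC (p z))).
{ intros p hp z; split; [exact (hp z)|].
  exact (@continuous_const _ R_UniformSpace 0 z). }
apply Ccontinuous_plus; (apply Ccontinuous_mult; [apply Ccontinuous_const|]);
  apply real; intros z.
- apply continuous_fst.
- apply continuous_snd.
Qed.

Lemma differentiable_Ccontinuous F : differentiable F -> Ccontinuous F.
Proof.
intros hF z.
pose proof (@filterdiff_continuous R_AbsRing R2 C_R_NormedModule F z (hF z)) as h.
split.
- apply (@continuous_comp R2 C_R_NormedModule R_UniformSpace F (fun w => Re w) z h),
    continuous_fst.
- apply (@continuous_comp R2 C_R_NormedModule R_UniformSpace F (fun w => Im w) z h),
    continuous_snd.
Qed.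

Lemma mixed_partials_R (f p q p2 q1 : R * R -> R) :
  (forall x y, is_derive (fun t => f (t, y)) x (p (x, y))) ->
  (forall x y, is_derive (fun t => f (x, t)) y (q (x, y))) ->
  (forall x y, is_derive (fun t => p (x, t)) y (p2 (x, y))) ->
  (forall x y, is_derive (fun t => q (t, y)) x (q1 (x, y))) ->
  (forall z, continuous p2 z) -> (forall z, continuous q1 z) ->
  forall z, p2 z = q1 z.
Proof.
intros hp hq hp2 hq1 cp2 cq1 [x y].
assert (dp : forall u v, Derive (fun t => f (t, v)) u = p (u, v)).
{ intros u v; now apply is_derive_unique. }
assert (dq : forall u v, Derive (fun t => f (u, t)) v = q (u, v)).
{ intros u v; now apply is_derive_unique. }
assert (dp2 : forall u v,
  is_derive (fun s => Derive (fun t => f (t, s)) u) v (p2 (u, v))).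
{ intros u v; apply (is_derive_ext (fun s : R => p (u, s))); auto. }
assert (dq1 : forall u v,
  is_derive (fun s => Derive (fun t => f (s, t)) v) u (q1 (u, v))).
{ intros u v; apply (is_derive_ext (fun s : R => q (s, v))); auto. }
etransitivity; [symmetry; exact (is_derive_unique _ _ _ (dp2 x y))|].
etransitivity; [|exact (is_derive_unique _ _ _ (dq1 x y))].
symmetry; apply (Schwarz (fun u v => f (u, v))).
- apply locally_2d_forall; intros u v; repeat split; eexists; auto.
- apply continuity_2d_pt_ext with (fun u v => q1 (u, v)).
  + intros u v; symmetry; now apply is_derive_unique.
  + apply continuity_2d_pt_filterlim.
    apply (filterlim_ext q1); [now intros [s t]|apply cq1].
- apply continuity_2d_pt_ext with (fun u v => p2 (u, v)).
  + intros u v; symmetry; now apply is_derive_unique.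
  + apply continuity_2d_pt_filterlim.
    apply (filterlim_ext p2); [now intros [s t]|apply cp2].
Qed.

(** Schwarz's theorem in the form suited to a first-order system: P and Q
stand for the right-hand sides of the system, whose derivatives can be written
down, and only the continuity of the two cross derivatives has to be checked. *)
Lemma mixed_partials F P Q P1 P2 Q1 Q2 :
  (forall z, is_grad F z (P z) (Q z)) ->
  (forall z, is_grad P z (P1 z) (P2 z)) ->
  (forall z, is_grad Q z (Q1 z) (Q2 z)) ->
  Ccontinuous P2 -> Ccontinuous Q1 ->
  forall z, P2 z = Q1 z.
Proof.
intros hF hP hQ cP cQ z; apply injective_projections.
- apply (mixed_partials_R (fun w => Re (F w)) (fun w => Re (P w))
    (fun w => Re (Q w)) (fun w => Re (P2 w)) (fun w => Re (Q1 w))).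
  + intros x y; apply (hF (x, y)).
  + intros x y; apply (hF (x, y)).
  + intros x y; apply (hP (x, y)).
  + intros x y; apply (hQ (x, y)).
  + intros w; apply cP.
  + intros w; apply cQ.
- apply (mixed_partials_R (fun w => Im (F w)) (fun w => Im (P w))
    (fun w => Im (Q w)) (fun w => Im (P2 w)) (fun w => Im (Q1 w))).
  + intros x y; apply (hF (x, y)).
  + intros x y; apply (hF (x, y)).
  + intros x y; apply (hP (x, y)).
  + intros x y; apply (hQ (x, y)).
  + intros w; apply cP.
  + intros w; apply cQ.
Qed.

(** * Combinations of exponentials *)

Definition expsum (gam : nat -> C * C) (c : nat -> C) (n : nat) (z : R * R) : C :=
  sum_n_m (fun l => c l * Cexp (dotC (gam l) z))%C 1 n.

Lemma expsum_O gam c z : expsum gam c 0 z = RtoC 0.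
Proof. apply (@sum_n_m_zero C_AbelianMonoid); lia. Qed.

Lemma expsum_S gam c m z :
  expsum gam c (S m) z =
  (expsum gam c m z + c (S m) * Cexp (dotC (gam (S m)) z))%C.
Proof. apply (@sum_n_Sm C_AbelianMonoid); lia. Qed.

Lemma expsum_ext gam c d n z :
  (forall l, (1 <= l <= n)%nat -> c l = d l) ->
  expsum gam c n z = expsum gam d n z.
Proof. intros h; apply (@sum_n_m_ext_loc C_AbelianMonoid); intros l hl; now rewrite h. Qed.

(** Every identity between exponential sums below is reduced, by nested uses of
this rule, to an identity between the coefficients. *)
Lemma expsum_lin gam k c d n z :
  expsum gam (fun l => k * c l + d l)%C n z =
  (k * expsum gam c n z + expsum gam d n z)%C.
Proof.
induction n as [|n IH].
- rewrite !expsum_O; ring.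
- rewrite !expsum_S, IH; ring.
Qed.

Lemma expsum_eq0 gam c n z :
  (forall l, (1 <= l <= n)%nat -> c l = RtoC 0) -> expsum gam c n z = RtoC 0.
Proof.
intros h; rewrite (expsum_ext gam c (fun l => RtoC (-1) * c l + c l)%C), expsum_lin.
- ring.
- intros l hl; rewrite h by exact hl; ring.
Qed.

Lemma is_grad_expsum gam c n z :
  is_grad (expsum gam c n) z
    (expsum gam (fun l => c l * fst (gam l))%C n z)
    (expsum gam (fun l => c l * snd (gam l))%C n z).
Proof.
induction n as [|n IH].
- rewrite (functional_extensionality (expsum gam c 0) (fun _ => RtoC 0))
    by apply expsum_O.
  rewrite !expsum_O; apply is_grad_const.
- rewrite (functional_extensionality _ _ (expsum_S gam c n)), !expsum_S,
    <- !Cmult_assoc.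
  apply is_grad_plus; [exact IH|]; apply is_grad_scal, is_grad_exp.
Qed.

Lemma Ccontinuous_expsum gam c n : Ccontinuous (expsum gam c n).
Proof.
induction n as [|n IH].
- rewrite (functional_extensionality (expsum gam c 0) (fun _ => RtoC 0))
    by apply expsum_O.
  apply Ccontinuous_const.
- rewrite (functional_extensionality _ _ (expsum_S gam c n)).
  apply Ccontinuous_plus; [exact IH|].
  apply Ccontinuous_mult; [apply Ccontinuous_const|].
  apply Ccontinuous_exp, Ccontinuous_dotC.
Qed.

Definition Csub2 (a b : C * C) : C * C := (fst a - fst b, snd a - snd b)%C.

Lemma Dop_expsum gam g v c n z :
  Dop g v (expsum gam c n) z =
  expsum gam (fun l => c l * dotC (Csub2 (gam l) g) v)%C n z.
Proof.
unfold Dop; rewrite (is_grad_unique _ _ _ _ (is_grad_expsum gam c n z)); simpl.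
transitivity (expsum gam (fun l => RtoC (fst v) * (c l * fst (gam l)) +
  (RtoC (snd v) * (c l * snd (gam l)) + ((- dotC g v) * c l + RtoC 0)))%C n z).
- rewrite !expsum_lin, (expsum_eq0 gam (fun _ => RtoC 0)) by easy.
  unfold dotC; simpl; ring.
- apply expsum_ext; intros l _; unfold dotC, Csub2; simpl; ring.
Qed.

(** The last exponential is multiplied by (gam_(m+1) - gam_(m+1)) . v = 0. *)
Lemma Dop_expsum_last gam v c m z :
  Dop (gam (S m)) v (expsum gam c (S m)) z =
  expsum gam (fun l => c l * dotC (Csub2 (gam l) (gam (S m))) v)%C m z.
Proof.
rewrite Dop_expsum, expsum_S; unfold dotC at 2, Csub2 at 2; simpl; ring.
Qed.

Lemma Dprod_expsum gam v n c z : Dprod gam v n (expsum gam c n) z = RtoC 0.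
Proof.
revert c; induction n as [|m IH]; intros c; simpl; [apply expsum_O|].
rewrite (functional_extensionality _ _ (Dop_expsum_last gam (v (S m)) c m)).
apply IH.
Qed.

Definition distinct_upto (gam : nat -> C * C) (n : nat) : Prop :=
  forall k l, (1 <= k <= n)%nat -> (1 <= l <= n)%nat -> k <> l -> gam k <> gam l.

Lemma Csub2_neq0 a b :
  a <> b -> fst (Csub2 a b) <> RtoC 0 \/ snd (Csub2 a b) <> RtoC 0.
Proof.
intros hab.
destruct (Ceq_dec (fst (Csub2 a b)) 0) as [e1 | h1]; [|now left].
destruct (Ceq_dec (snd (Csub2 a b)) 0) as [e2 | h2]; [|now right].
exfalso; apply hab, injective_projections.
- transitivity (fst (Csub2 a b) + fst b)%C; [|rewrite e1]; simpl; ring.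
- transitivity (snd (Csub2 a b) + snd b)%C; [|rewrite e2]; simpl; ring.
Qed.

Lemma dotC_e1 a : dotC a (1, 0) = fst a.
Proof. unfold dotC; simpl; ring. Qed.

Lemma dotC_e2 a : dotC a (0, 1) = snd a.
Proof. unfold dotC; simpl; ring. Qed.

Lemma Cmult_integral_l a b : (a * b)%C = RtoC 0 -> b <> RtoC 0 -> a = RtoC 0.
Proof.
intros h hb; transitivity (a * b / b)%C; [now field|rewrite h; now field].
Qed.

(** Applying the operator of the last frequency to a vanishing combination
shortens it by one term and multiplies c_l by (gam_l - gam_n) . v.  One of the
two coordinate directions makes this factor nonzero, so c_l = 0 for l < n by
induction; what remains is one exponential, which vanishes nowhere. *)
Lemma expsum_independent gam n c :
  distinct_upto gam n -> (forall z, expsum gam c n z = RtoC 0) ->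
  forall l, (1 <= l <= n)%nat -> c l = RtoC 0.
Proof.
revert c; induction n as [|m IH]; intros c hd h0; [intros; lia|].
assert (hD : forall v z,
  expsum gam (fun l => c l * dotC (Csub2 (gam l) (gam (S m))) v)%C m z = RtoC 0).
{ intros v z; rewrite <- Dop_expsum_last.
  rewrite (functional_extensionality _ _ h0); unfold Dop.
  rewrite (is_grad_unique _ _ _ _ (is_grad_const (RtoC 0) z)).
  unfold dotC; simpl; ring. }
assert (hc : forall l, (1 <= l <= m)%nat -> c l = RtoC 0).
{ assert (hd' : distinct_upto gam m) by (intros k l hk hl; apply hd; lia).
  intros l hl.
  pose proof (IH _ hd' (hD (1, 0)) l hl) as h1.
  pose proof (IH _ hd' (hD (0, 1)) l hl) as h2.
  cbv beta in h1, h2; rewrite dotC_e1 in h1; rewrite dotC_e2 in h2.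
  assert (hne : gam l <> gam (S m)) by (apply hd; lia).
  destruct (Csub2_neq0 _ _ hne) as [h | h];
    [exact (Cmult_integral_l _ _ h1 h) | exact (Cmult_integral_l _ _ h2 h)]. }
intros l hl; destruct (Nat.eq_dec l (S m)) as [-> | hlm]; [|apply hc; lia].
apply Cmult_integral_l with (Cexp (dotC (gam (S m)) (0, 0))); [|apply Cexp_neq0].
rewrite <- (h0 (0, 0)), expsum_S, (expsum_eq0 gam c m) by exact hc; ring.
Qed.

(** * The inhomogeneous first-order system *)

(** A solution F forces the coefficient vectors (a_l, b_l) to be parallel to
gam_l - g, which is the integrability condition of the system; the factors d_l
then give a particular solution, and the rest is homogeneous. *)
Lemma exp_system_solve gam g n a b F :
  differentiable F ->
  distinct_upto gam n ->
  (forall l, (1 <= l <= n)%nat -> gam l <> g) ->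
  (forall z, is_grad F z (fst g * F z + expsum gam a n z)%C
                         (snd g * F z + expsum gam b n z)%C) ->
  exists d k, forall z,
    F z = (expsum gam d n z + k * Cexp (dotC g z))%C.
Proof.
intros hF hd hg hgrad.
assert (compat : forall l, (1 <= l <= n)%nat ->
  (a l * snd (Csub2 (gam l) g) = b l * fst (Csub2 (gam l) g))%C).
{ set (c := fun l => (a l * snd (Csub2 (gam l) g) +
                      RtoC (-1) * (b l * fst (Csub2 (gam l) g)))%C).
  assert (h0 : forall z, expsum gam c n z = RtoC 0).
  { intros z.
    (* The four sums are the contributions of d_2 A, A, d_1 B and B to the
       difference of the mixed derivatives; the terms g_1 g_2 F cancel. *)
    rewrite (expsum_ext gam c (fun l => RtoC 1 * (a l * snd (gam l)) +
      (- snd g * a l + (RtoC (-1) * (b l * fst (gam l)) +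
      (fst g * b l + RtoC 0))))%C)
      by (intros l _; unfold c, Csub2; simpl; ring).
    rewrite !expsum_lin, (expsum_eq0 gam (fun _ => RtoC 0)) by easy.
    assert (cF := differentiable_Ccontinuous F hF).
    pose proof (mixed_partials F _ _ _ _ _ _ hgrad
      (fun w => is_grad_plus _ _ _ _ _ _ _ (is_grad_scal (fst g) _ _ _ _ (hgrad w))
        (is_grad_expsum gam a n w))
      (fun w => is_grad_plus _ _ _ _ _ _ _ (is_grad_scal (snd g) _ _ _ _ (hgrad w))
        (is_grad_expsum gam b n w))) as h.
    assert (cont : forall p q c d, Ccontinuous (fun w =>
      p * (q * F w + expsum gam c n w) + expsum gam d n w)%C).
    { intros p q c' d'; apply Ccontinuous_plus; [|apply Ccontinuous_expsum].
      apply Ccontinuous_mult; [apply Ccontinuous_const|].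
      apply Ccontinuous_plus; [|apply Ccontinuous_expsum].
      apply Ccontinuous_mult; [apply Ccontinuous_const|exact cF]. }
    specialize (h (cont _ _ _ _) (cont _ _ _ _) z).
    cbv beta in h; apply Ceq_minus in h; etransitivity; [|exact h]; ring. }
  intros l hl; pose proof (expsum_independent gam n c hd h0 l hl) as h.
  apply Ceq_minus; rewrite <- h; unfold c; ring. }
set (d := fun l => if Ceq_dec (fst (Csub2 (gam l) g)) 0
                   then (b l / snd (Csub2 (gam l) g))%C
                   else (a l / fst (Csub2 (gam l) g))%C).
assert (hdab : forall l, (1 <= l <= n)%nat ->
  a l = (d l * fst (Csub2 (gam l) g))%C /\ b l = (d l * snd (Csub2 (gam l) g))%C).
{ intros l hl; unfold d; pose proof (compat l hl) as e.
  pose proof (Csub2_neq0 _ _ (hg l hl)) as h.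
  destruct (Ceq_dec _ _) as [h1 | h1].
  - destruct h as [h | h]; [easy|].
    rewrite h1 in e |- *; split; [|now field].
    rewrite Cmult_0_r in e |- *; now apply Cmult_integral_l with (2 := h).
  - split; [now field|].
    transitivity (b l * fst (Csub2 (gam l) g) / fst (Csub2 (gam l) g))%C;
      [|rewrite <- e]; now field. }
assert (hG : forall z, is_grad (fun w => F w + RtoC (-1) * expsum gam d n w)%C z
  (fst g * (F z + RtoC (-1) * expsum gam d n z))%C
  (snd g * (F z + RtoC (-1) * expsum gam d n z))%C).
{ intros z; eapply is_grad_eq.
  - apply is_grad_plus; [apply hgrad|apply is_grad_scal, is_grad_expsum].
  - rewrite (expsum_ext gam a (fun l => RtoC 1 * (d l * fst (gam l)) +
      (- fst g * d l + RtoC 0))%C).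
    + rewrite !expsum_lin, (expsum_eq0 gam (fun _ => RtoC 0)) by easy; ring.
    + intros l hl; rewrite (proj1 (hdab l hl)); unfold Csub2; simpl; ring.
  - rewrite (expsum_ext gam b (fun l => RtoC 1 * (d l * snd (gam l)) +
      (- snd g * d l + RtoC 0))%C).
    + rewrite !expsum_lin, (expsum_eq0 gam (fun _ => RtoC 0)) by easy; ring.
    + intros l hl; rewrite (proj2 (hdab l hl)); unfold Csub2; simpl; ring. }
destruct (eigen_exp g _ hG) as [k hk].
exists d, k; intros z; rewrite <- hk; ring.
Qed.

(** * Characterization of exponential sums *)

Lemma Dprod_ext gam v w n F :
  (forall l, (1 <= l <= n)%nat -> v l = w l) ->
  Dprod gam v n F = Dprod gam w n F.
Proof.
revert F; induction n as [|m IH]; intros F h; [reflexivity|simpl].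
rewrite h by lia; apply IH; intros; apply h; lia.
Qed.

(** For n = 0 both sides say that F vanishes, which starts the induction. *)
Lemma annihilated_is_expsum gam n F :
  distinct_upto gam n -> n_differentiable n F ->
  (forall v : nat -> R * R, (forall l, (1 <= l <= n)%nat -> in_U (v l)) ->
     forall z, Dprod gam v n F z = RtoC 0) ->
  exists c, forall z, F z = expsum gam c n z.
Proof.
revert F; induction n as [|m IH]; intros F hd hF hv.
- exists (fun _ => RtoC 0); intros z; rewrite expsum_O.
  apply (hv (fun _ => (1, 0))); intros; lia.
- assert (hd' : distinct_upto gam m) by (intros k l hk hl; apply hd; lia).
  assert (hD : forall u, in_U u -> exists c, forall z,
    Dop (gam (S m)) u F z = expsum gam c m z).
  { intros u hu; apply IH; [exact hd'|now apply n_differentiable_Dop|].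
    intros v hvU z.
    set (w := fun l => if Nat.eq_dec l (S m) then u else v l).
    rewrite <- (hv w) with (z := z).
    - simpl; rewrite (Dprod_ext gam w v).
      + unfold w; now destruct (Nat.eq_dec (S m) (S m)).
      + intros l hl; unfold w; destruct (Nat.eq_dec l (S m)); [lia|easy].
    - intros l hl; unfold w; destruct (Nat.eq_dec l (S m)); [exact hu|].
      apply hvU; lia. }
  destruct (hD (1, 0)) as [a ha].
  { unfold in_U; simpl; transitivity (sqrt 1); [f_equal; ring | apply sqrt_1]. }
  destruct (hD (0, 1)) as [b hb].
  { unfold in_U; simpl; transitivity (sqrt 1); [f_equal; ring | apply sqrt_1]. }
  destruct (exp_system_solve gam (gam (S m)) m a b F) as [d [k hdk]].
  + apply hF.
  + exact hd'.
  + intros l hl; apply hd; lia.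
  + intros z; eapply is_grad_eq; [apply differentiable_is_grad, hF| |].
    * rewrite <- ha; unfold Dop; rewrite dotC_e1; simpl; ring.
    * rewrite <- hb; unfold Dop; rewrite dotC_e2; simpl; ring.
  + exists (fun l => if Nat.eq_dec l (S m) then k else d l); intros z.
    rewrite hdk, expsum_S; f_equal.
    * apply expsum_ext; intros l hl; destruct (Nat.eq_dec l (S m)); [lia|easy].
    * now destruct (Nat.eq_dec (S m) (S m)).
Qed.

Theorem theorem2p4 (n : nat) (hn : (1 <= n)%nat)
    (gam : nat -> C * C)
    (hgam : forall l, (1 <= l <= n)%nat -> in_D2 (gam l))
    (hdist : forall k l, (1 <= k <= n)%nat -> (1 <= l <= n)%nat ->
       k <> l -> gam k <> gam l)
    (F : R * R -> C) (hF : n_differentiable n F) :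
  (forall v : nat -> R * R,
     (forall l, (1 <= l <= n)%nat -> in_U (v l)) ->
     forall z : R * R, Dprod gam v n F z = RtoC 0)
  <->
  (exists c : nat -> C,
     forall z : R * R,
       F z = sum_n_m (fun l => c l * Cexp (dotC (gam l) z))%C 1 n).
Proof.
split.
- now apply annihilated_is_expsum.
- intros [c hc] v _ z.
  rewrite (functional_extensionality F (expsum gam c n) hc).
  apply Dprod_expsum.
Qed.
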